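(* Let $\mathcal Z$, $\mathcal X$, $\mathcal F_{\mathcal Y|\mathcal X}$, $\Gamma\colon\mathcal F_{\mathcal Y|\mathcal X}\to\Xi\subseteq\mathbb R^k$, $\Theta\subseteq\mathbb R^q$ and $m\colon\mathbb R^p\times\Theta\to\Xi$ be as in the context, and suppose that for all $Z=(Y,X)\in\mathcal Z$ there is a unique parameter $\theta_0=\theta_0(F_Z)\in\operatorname{int}(\Theta)$ (unique among all parameters in $\Theta$) such that almost surely $m(X,\theta_0)=\Gamma(F_{Y|X})$. Let $\rho\colon\mathbb R^d\times\Xi\to\mathbb R$ be a loss function with $\mathbb E|\rho(Y,m(X,\theta))|<\infty$ for all $(Y,X)\in\mathcal Z$ and all $\theta\in\Theta$. Then the following hold. (i) If $\rho$ is $\mathcal F_{\mathcal Y|\mathcal X}$-consistent for $\Gamma$, then $\rho$ is conditionally $\mathcal F_{\mathcal Z}$-model-consistent for $m$. If $\rho$ is strictly $\mathcal F_{\mathcal Y|\mathcal X}$-consistent for $\Gamma$, then $\rho$ is strictly conditionally $\mathcal F_{\mathcal Z}$-model-consistent for $m$. (ii) Suppose that for all $X\in\mathcal X$ the map $m(X,\cdot)\colon\Theta\to\Xi$ is surjective almost surely, and that for all $(Y,X)\in\mathcal Z$ the conditional expectation $\mathbb E[\rho(Y,m(X,\theta))\,|\,X]$ is continuous in $\theta$ almost surely. If $\rho$ is conditionally $\mathcal F_{\mathcal Z}$-model-consistent for $m$, then there is a modification $\widetilde{\mathcal F}_{\mathcal Y|\mathcal X}$ of $\mathcal F_{\mathcal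 Y|\mathcal X}$ such that $\rho$ is $\widetilde{\mathcal F}_{\mathcal Y|\mathcal X}$-consistent for $\Gamma$. (iii) If $\rho$ is conditionally $\mathcal F_{\mathcal Z}$-model-consistent for $m$, then $\rho$ is unconditionally $\mathcal F_{\mathcal Z}$-model-consistent for $m$. If $\rho$ is strictly conditionally $\mathcal F_{\mathcal Z}$-model-consistent for $m$, then $\rho$ is strictly unconditionally $\mathcal F_{\mathcal Z}$-model-consistent for $m$. (iv) Suppose that for any $Z=(Y,X)\in\mathcal Z$ and any event $A\in\sigma(X)$ with $\mathbb P(A)>0$ there is some $\widetilde Z\in\mathcal Z$ such that $\mathbb P(\widetilde Z\in B)=\mathbb P(Z\in B\,|\,A)$ for all Borel sets $B\subseteq\mathbb R^{d+p}$. If $\rho$ is unconditionally $\mathcal F_{\mathcal Z}$-model-consistent for $m$, then $\rho$ is conditionally $\mathcal F_{\mathcal Z}$-model-consistent for $m$. If $\rho$ is strictly unconditionally $\mathcal F_{\mathcal Z}$-model-consistent for $m$, then $\rho$ is strictly conditionally $\mathcal F_{\mathcal Z}$-model-consistent for $m$.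
   Context: Setting. $(\Omega,\mathcal A,\mathbb P)$ is a non-atomic, complete probability space on which all random variables are defined. $\mathcal Y$ is a class of $\mathbb R^d$-valued response variables, $\mathcal X$ a corresponding class of $\mathbb R^p$-valued regressors, and $\mathcal Z$ the class of possible response--regressor pairs $Z=(Y,X)$, $Y\in\mathcal Y$, $X\in\mathcal X$. $F_Z$ is the distribution of $Z$ and $\mathcal F_{\mathcal Z}=\{F_Z : Z\in\mathcal Z\}$. For $(Y,X)\in\mathcal Z$, $F_{Y|X}=F_{Y|X}(\cdot,\omega)$ denotes a regular version of the conditional distribution of $Y$ given $X$. Distribution functions are identified with the corresponding measures. The class $\mathcal F_{\mathcal Y|\mathcal X}$ and its modifications. $\mathcal F_{\mathcal Y|\mathcal X}$ is a collection of distributions on $\mathbb R^d$ such that for any $(Y,X)\in\mathcal Z$ a regular version of $F_{Y|X}$ is an element of $\mathcal F_{\mathcal Y|\mathcal X}$ almost surely. It is induced by a map $\mathcal Z\ni Z\mapsto\Omega_Z\in\{\Omega'\in\mathcal A : \mathbb P(\Omega')=1\}$, in that $\mathcal F_{\mathcal Y|\mathcal X}$ is the union over all $Z=(Y,X)\in\mathcal Z$ of the collections $\{F_{Y|X}(\cdot,\omega) : \omega\in\Omega_Z\}$. It is not unique: the classes obtained from different choices of the map $Z\mapsto\Omega_Z$ are called modifications of $\mathcal F_{\mathcal Y|\mathcal X}$. $\Gamma\colon\mathcal F_{\mathcal Y|\mathcal X}\to\Xi\subseteq\mathbb R^k$ is a single-valued functional; $\Theta\subseteq\mathbb R^q$ is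 a parameter space with non-empty interior $\operatorname{int}(\Theta)$; $m\colon\mathbb R^p\times\Theta\to\Xi$ is a parametric model. $\theta_0=\theta_0(F_Z)$ is the true parameter of $Z=(Y,X)\in\mathcal Z$. Conditional expectations $\mathbb E[\rho(Y,m(X,\theta))|X]$ are understood as computed from the regular conditional distribution, i.e. as $\int\rho(y,m(X(\omega),\theta))\,F_{Y|X}(\mathrm dy,\omega)$. Consistency. For a class $\mathcal F$ of probability distributions on $\mathbb R^d$, a loss $\rho\colon\mathbb R^d\times\Xi\to\mathbb R$ is $\mathcal F$-consistent for $\Gamma\colon\mathcal F\to\Xi$ if $\rho(\cdot,\xi)$ is $F$-integrable for all $F\in\mathcal F$ and $\xi\in\Xi$, and $$\int\rho(y,\Gamma(F))\,\mathrm dF(y)\le\int\rho(y,\xi)\,\mathrm dF(y)\quad\text{for all }F\in\mathcal F,\ \xi\in\Xi.$$ It is strictly $\mathcal F$-consistent for $\Gamma$ if, in addition, equality implies $\xi=\Gamma(F)$. Model-consistency. $\rho$ is unconditionally $\mathcal F_{\mathcal Z}$-model-consistent for $m$ if $$\mathbb E[\rho(Y,m(X,\theta_0))]\le\mathbb E[\rho(Y,m(X,\theta))]\quad\text{for all }(Y,X)\in\mathcal Z,\ \theta\in\Theta,$$ and strictly so if, in addition, equality implies $\theta=\theta_0$. $\rho$ is conditionally $\mathcal F_{\mathcal Z}$-model-consistent for $m$ if $$\mathbb E[\rho(Y,m(X,\theta_0))|X]\le\mathbb E[\rho(Y,m(X,\theta))|X]\ \text{ a.s. for all }(Y,X)\in\mathcal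 Z,\ \theta\in\Theta,$$ and strictly so if, in addition, almost sure equality implies $\theta=\theta_0$.
   Formalization: Measurability is made explicit: (y,x) ↦ ρ(y,m(x,θ)) is Borel for each θ; in (iv) Γ is also assumed measurable on the class of conditional distributions and m(·,θ) Borel, since (iv) fails for some non-measurable Γ. *)

(* Defs.v *)
From HB Require Import structures.
From mathcomp Require Import all_boot all_order all_algebra.
From mathcomp Require Import all_classical all_reals all_analysis.
From mathcomp Require Import measurable_realfun.
Set Implicit Arguments.
Unset Strict Implicit.
Unset Printing Implicit Defensive.
Import Order.TTheory GRing.Theory Num.Theory.
Import numFieldNormedType.Exports.
Local Open Scope classical_set_scope.
Local Open Scope ring_scope.

(* R^d, R^p and R^k are rendered as [n.-tuple R], whose library sigma-algebra
   (generated by the coordinates) is the Borel one; the parameter space lives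
   in ['rV[R]_q], which carries the topology of R^q. Functions that the
   mathematics defines on a subset (rho on Xi, m on Theta, Gamma on a class of
   distributions) are total here and only evaluated on that subset. *)

Definition nonatomic d0 (Omega : measurableType d0) (R : realType)
    (P : probability Omega R) : Prop :=
  forall A, measurable A -> (0 < P A)%E ->
  exists B, [/\ measurable B, B `<=` A, (0 < P B)%E & (P B < P A)%E].

(* Measurability of [f] restricted to a possibly non-measurable [D], for the
   trace sigma-algebra on [D]; [measurable_fun D f] holds vacuously when [D] is
   not measurable. *)
Definition measurable_in_trace d1 d2 (T1 : measurableType d1)
    (T2 : measurableType d2) (D : set T1) (f : T1 -> T2) : Prop :=
  forall B, measurable B ->
  exists2 E, measurable E & D `&` f @^-1` B = D `&` E.

Section pair_rv.
Context d0 d1 d2 (Omega : measurableType d0) (T1 : measurableType d1)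
  (T2 : measurableType d2) (R : realType) (P : probability Omega R).

Definition pair_rv (Z : {RV P >-> T1} * {RV P >-> T2}) : Omega -> T1 * T2 :=
  fun w => (Z.1 w, Z.2 w).

Variable Z : {RV P >-> T1} * {RV P >-> T2}.

Let measurable_pair_rv : measurable_fun setT (pair_rv Z).
Proof.
by apply/measurable_fun_pairP; split; exact: (@measurable_funPT _ _ _ _ _).
Qed.

HB.instance Definition _ :=
  isMeasurableFun.Build _ _ _ _ (pair_rv Z) measurable_pair_rv.

End pair_rv.

Section consistency.
Context dT (T : measurableType dT) (U : Type) (R : realType).
Variables (F : set (pprobability T R)) (Xi : set U).
Variables (Gamma : pprobability T R -> U) (rho : T -> U -> R).
Local Open Scope ereal_scope.

Definition consistent : Prop :=
  (forall mu xi, F mu -> Xi xi ->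
     mu.-integrable setT (fun y => (rho y xi)%:E)) /\
  (forall mu xi, F mu -> Xi xi ->
     \int[mu]_y (rho y (Gamma mu))%:E <= \int[mu]_y (rho y xi)%:E).

Definition strictly_consistent : Prop :=
  consistent /\
  forall mu xi, F mu -> Xi xi ->
    \int[mu]_y (rho y (Gamma mu))%:E = \int[mu]_y (rho y xi)%:E ->
    xi = Gamma mu.

End consistency.

Section regression.
Context d0 (Omega : measurableType d0) (R : realType).
Variables (P : probability Omega R) (d p k q : nat).

Local Notation rvpair :=
  ({RV P >-> d.-tuple R} * {RV P >-> p.-tuple R})%type.

(* [K w] is F_{Y|X}(., w): it is sigma(X)-measurable in w and disintegrates the
   law of Y over the events of sigma(X). *)
Definition regular_cond_dist (Z : rvpair)
    (K : Omega -> pprobability (d.-tuple R) R) : Prop :=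
  (forall B, measurable B ->
     measurable_fun setT
       (fun w : g_sigma_algebra_preimageType Z.2 => K w B)) /\
  (forall A B, g_sigma_algebra_preimage Z.2 A -> measurable B ->
     (\int[P]_(w in A) K w B = P (A `&` Z.1 @^-1` B))%E).

Variables (Zs : set rvpair).
Variable K : rvpair -> Omega -> pprobability (d.-tuple R) R.

Definition full_measure_choice (Om : rvpair -> set Omega) : Prop :=
  forall Z, Zs Z -> measurable (Om Z) /\ P (Om Z) = 1%E.

(* The modifications of the class are obtained by varying [Om] among the
   choices satisfying [full_measure_choice]. *)
Definition cond_dist_class (Om : rvpair -> set Omega) :
    set (pprobability (d.-tuple R) R) :=
  \bigcup_(Z in Zs) (K Z @` Om Z).

Variables (Theta : set 'rV[R]_q) (m : p.-tuple R -> 'rV[R]_q -> k.-tuple R).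
Variable theta0 : pprobability (d.-tuple R * p.-tuple R)%type R -> 'rV[R]_q.
Variable rho : d.-tuple R -> k.-tuple R -> R.

Definition true_parameter (Z : rvpair) : 'rV[R]_q :=
  theta0 (distribution P (pair_rv Z)).

Definition risk (Z : rvpair) (theta : 'rV[R]_q) : \bar R :=
  'E_P[fun w => rho (Z.1 w) (m (Z.2 w) theta)].

Definition cond_risk (Z : rvpair) (theta : 'rV[R]_q) (w : Omega) : \bar R :=
  (\int[K Z w]_y (rho y (m (Z.2 w) theta))%:E)%E.

Definition uncond_model_consistent : Prop :=
  forall Z theta, Zs Z -> Theta theta ->
    (risk Z (true_parameter Z) <= risk Z theta)%E.

Definition strictly_uncond_model_consistent : Prop :=
  uncond_model_consistent /\
  forall Z theta, Zs Z -> Theta theta ->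
    risk Z (true_parameter Z) = risk Z theta -> theta = true_parameter Z.

Definition cond_model_consistent : Prop :=
  forall Z theta, Zs Z -> Theta theta ->
    {ae P, forall w,
      (cond_risk Z (true_parameter Z) w <= cond_risk Z theta w)%E}.

Definition strictly_cond_model_consistent : Prop :=
  cond_model_consistent /\
  forall Z theta, Zs Z -> Theta theta ->
    {ae P, forall w, cond_risk Z (true_parameter Z) w = cond_risk Z theta w} ->
    theta = true_parameter Z.

(* The conditional risk is a real-valued continuous function of theta, so it is
   finite for all theta outside a single null set. *)
Definition cond_risk_continuous (Z : rvpair) : Prop :=
  {ae P, forall w,
    (forall theta, Theta theta -> cond_risk Z theta w \is a fin_num) /\
    {within Theta, continuous (fun theta => fine (cond_risk Z theta w))}}.

Definition closed_under_conditioning : Prop :=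
  forall Z A, Zs Z -> g_sigma_algebra_preimage Z.2 A -> (0 < P A)%E ->
  exists2 Z', Zs Z' &
    forall B, measurable B ->
      (P (pair_rv Z' @^-1` B) = P (pair_rv Z @^-1` B `&` A) / P A)%E.

End regression.

(* Main.v *)
Require Import Defs.
From HB Require Import structures.
From mathcomp Require Import all_boot all_order all_algebra.
From mathcomp Require Import all_classical all_reals all_analysis.
From mathcomp Require Import measurable_realfun.
Import Order.TTheory GRing.Theory Num.Theory.
Import numFieldNormedType.Exports.
Set Implicit Arguments.
Unset Strict Implicit.
Unset Printing Implicit Defensive.
Local Open Scope classical_set_scope.
Local Open Scope ring_scope.

(** Everything rests on the disintegration formula: integrating the conditional
    risk over an event of sigma(X) gives the integral of the loss over that
    event ([integral_cond]). The regular conditional distribution provides it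
    for indicators of rectangles, and the kernel obtained by mixing the
    conditional laws over P therefore is the law of (Y, X).

    (i) Outside a null set the conditional law K(w) belongs to the class and
    m(X(w), theta0) = Gamma(K(w)), so the inequality of consistency at
    F = K(w) and xi = m(X(w), theta) is the inequality of conditional
    model-consistency. In the strict case, equality of the conditional risks
    gives m(X, theta) = Gamma(K) almost surely, hence theta = theta0.

    (ii) For each fixed theta the conditional inequality fails on a null set
    only. The union of these null sets over a countable dense part of Theta is
    null, and continuity extends the inequality to all theta at once. By
    surjectivity of m(X(w), .) this is the inequality of consistency for
    K(w), and the modification keeps exactly such w. A conditional risk that is
    finite is the integral of an integrable function, because a difference of
    two nonnegative extended reals can only be finite if both are.

    (iii) Integrate; equality of two integrals of ordered integrable functions
    forces almost sure equality ([ae_le_integral_eq]).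

    (iv) Let A be the event of sigma(X) on which theta has smaller conditional
    risk than theta0 = theta0(F_Z). If P(A) > 0, some pair Z' = (Y', X') has the
    law of Z given A. If theta0 is also the true parameter of Z', then
    unconditional consistency for Z' says that the integral over A of the
    conditional risk at theta0 is at most the one at theta, contradicting the
    choice of A. That theta0 is the true parameter of Z' is the delicate point:
    one has to carry the identity m(X, theta0) = Gamma(K) from Z to Z'
    ([transfer_functional]), although the conditional distributions K of Z and
    K' of Z' are unrelated as functions on Omega. The link is that every
    measurable set E of distributions has a Borel set C such that
    K in E iff X in C, and almost surely K' in E iff X' in C
    ([transfer_kernel_event]). Such sets E form a sigma-algebra, and for the
    generators {mu | mu(B) < r} the claim follows by comparing the integrals of
    K(B) and K'(B) over sets on which one of them is below r and the other is
    not. *)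

(** * Null sets and integrals *)

Section almost_everywhere.
Context d (T : measurableType d) (R : realType).

Lemma ae_forall_countable (mu : {measure set T -> \bar R}) (I : countType)
    (Q : I -> T -> Prop) :
  (forall i, {ae mu, forall x, Q i x}) -> {ae mu, forall x, forall i, Q i x}.
Proof.
move=> aeQ.
have : {ae mu, forall x, forall n,
    if unpickle n is Some i then Q i x else True}.
  apply: ae_foralln => n; case: (unpickle n) => [i|]; first exact: aeQ.
  exact: aeW.
by apply: filterS => x Qx i; have := Qx (pickle i); rewrite pickleK.
Qed.

Lemma ae_notin (mu : {measure set T -> \bar R}) (N : set T) :
  measurable N -> mu N = 0%E -> {ae mu, forall x, ~ N x}.
Proof. by move=> mN N0; exists N; split => // x /= /contrapT. Qed.

Lemma ae_notin_null (mu : {measure set T -> \bar R}) (N : set T) :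
  measurable N -> {ae mu, forall x, ~ N x} -> mu N = 0%E.
Proof.
move=> mN [M [mM M0 NM]]; apply: (subset_measure0 mN mM _ M0) => x Nx.
by apply: NM => /=; apply.
Qed.

Lemma ae_full (mu : probability T R) (D : set T) :
  measurable D -> mu D = 1%E -> {ae mu, forall x, D x}.
Proof.
move=> mD D1; exists (~` D); split => //; first exact: measurableC.
by rewrite probability_setC// [X in (_ - X)%E]D1 subee.
Qed.

End almost_everywhere.

Section integral_facts.
Context d (T : measurableType d) (R : realType).
Variable mu : {measure set T -> \bar R}.
Local Open Scope ereal_scope.

Lemma integral_compE (U : Type) (D : set T) (phi : T -> U) (g : U -> \bar R) :
  \int[mu]_(x in D) g (phi x) =
  \int[mu]_(x in D) g^\+ (phi x) - \int[mu]_(x in D) g^\- (phi x).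
Proof.
rewrite [LHS]integralE; congr (_ - _); apply: eq_integral => x _.
- by rewrite (funepos_comp g phi).
- by rewrite (funeneg_comp g phi).
Qed.

(** The integral is the difference of the integrals of the positive and the
    negative part, where [+oo - +oo] is [-oo]: it is finite only if both parts
    are. *)
Lemma fin_num_integrable (D : set T) (f : T -> \bar R) :
  measurable D -> measurable_fun D f ->
  \int[mu]_(x in D) f x \is a fin_num -> mu.-integrable D f.
Proof.
move=> mD mf; rewrite integralE => ffin; apply/integrableP; split => //.
have p0 : 0 <= \int[mu]_(x in D) f^\+ x by exact: integral_ge0.
have n0 : 0 <= \int[mu]_(x in D) f^\- x by exact: integral_ge0.
have -> : \int[mu]_(x in D) `|f x| =
    \int[mu]_(x in D) f^\+ x + \int[mu]_(x in D) f^\- x.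
  rewrite -ge0_integralD//.
  - by apply: eq_integral => x _; rewrite -[LHS]/((abse \o f) x) fune_abse.
  - exact: measurable_funepos.
  - exact: measurable_funeneg.
move: p0 n0 ffin; case: (\int[mu]_(x in D) f^\+ x) => [a||]//;
  case: (\int[mu]_(x in D) f^\- x) => [b||]//= _ _ _.
by rewrite -EFinD ltry.
Qed.

Lemma ae_le_integral (D : set T) (f g : T -> \bar R) :
  measurable D -> mu.-integrable D f -> mu.-integrable D g ->
  {ae mu, forall x, D x -> f x <= g x} ->
  \int[mu]_(x in D) f x <= \int[mu]_(x in D) g x.
Proof.
move=> mD fi gi fg; pose h x := maxe (f x) (g x).
have mf := measurable_int _ fi; have mg := measurable_int _ gi.
have mh : measurable_fun D h by exact: measurable_maxe.
have gh : ae_eq mu D g h.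
  by apply: filterS fg => x fg Dx; rewrite /h; apply/esym/max_idPr; exact: fg.
have hi : mu.-integrable D h.
  have : mu.-integrable D ((abse \o f) \+ (abse \o g)).
    by apply: integrableD => //; exact: integrable_abse.
  apply: le_integrable => // x Dx /=; rewrite [leRHS]gee0_abs ?adde_ge0//.
  rewrite /h /maxe; case: ifP => _; last by rewrite leeDl.
  by rewrite leeDr.
rewrite (ae_eq_integral h g)//; apply: le_integral => //.
by move=> x _; rewrite le_max lexx.
Qed.

(** Strict inequality on one part of [D] could not be compensated on the rest,
    so the integrals agree on every measurable part of [D]. *)
Lemma ae_le_integral_eq (D : set T) (f g : T -> \bar R) :
  measurable D -> mu.-integrable D f -> mu.-integrable D g ->
  {ae mu, forall x, D x -> f x <= g x} ->
  \int[mu]_(x in D) f x = \int[mu]_(x in D) g x ->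
  ae_eq mu D f g.
Proof.
move=> mD fi gi fg fgE; have mg := measurable_int _ gi.
have mf := measurable_int _ fi.
apply: integral_ae_eq => // E ED mE.
have mDE : measurable (D `\` E) by exact: measurableD.
have part h : measurable_fun D h -> \int[mu]_(x in D) h x =
    \int[mu]_(x in E) h x + \int[mu]_(x in D `\` E) h x.
  move=> mh; rewrite -integral_setU//.
  - by rewrite setDUK.
  - by rewrite setDUK.
  - by apply/disj_setPS => x [Ex []].
have le A : A `<=` D -> measurable A ->
    \int[mu]_(x in A) f x <= \int[mu]_(x in A) g x.
  move=> AD mA; apply: ae_le_integral => //.
  - exact: integrableS fi.
  - exact: integrableS gi.
  - by apply: filterS fg => x + /AD; apply.
have fin h A : mu.-integrable D h -> A `<=` D -> measurable A ->
    \int[mu]_(x in A) h x \is a fin_num.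
  by move=> hi AD mA; apply: integrable_fin_num => //; exact: integrableS hi.
apply/eqP; rewrite eq_le le//=.
have := fgE; rewrite (part f)// (part g)// => /eqP.
rewrite leNgt; apply: contraTN => lt.
rewrite lt_eqF//; apply: lte_leD => //.
  exact: fin.
exact: le (@subDsetl _ _ _) mDE.
Qed.

End integral_facts.

Section threshold.
Context d (T : measurableType d) (R : realType)
  (mu : {finite_measure set T -> \bar R}).
Local Open Scope ereal_scope.

Lemma le_threshold_integral (E : set T) (f : T -> \bar R) (r : R) :
  measurable E -> measurable_fun E f -> (0 <= r)%R ->
  (forall x, E x -> r%:E <= f x) -> r%:E * mu E <= \int[mu]_(x in E) f x.
Proof.
by move=> mE mf r0 rf; rewrite -integral_cst//; apply: ge0_le_integral.
Qed.

Lemma lt_threshold_null (E : set T) (f : T -> \bar R) (r : R) :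
  measurable E -> measurable_fun E f -> (forall x, E x -> 0 <= f x) ->
  (forall x, E x -> f x < r%:E) ->
  r%:E * mu E <= \int[mu]_(x in E) f x -> mu E = 0.
Proof.
move=> mE mf f0 fr rf.
have ci : mu.-integrable E (cst r%:E).
  by apply: finite_measure_integrable_cst.
have fi : mu.-integrable E f.
  apply: (le_integrable mE mf _ ci) => x Ex /=.
  by rewrite gee0_abs ?f0// (le_trans (ltW (fr x Ex)))// lee_abs.
have : ae_eq mu E f (cst r%:E).
  apply: ae_le_integral_eq => //.
    by apply: aeW => x Ex; rewrite ltW// fr.
  apply/eqP; rewrite eq_le integral_cst// rf andbT -integral_cst//.
  apply: le_integral => // x /set_mem Ex; by rewrite ltW// fr.
move=> fE; apply: ae_notin_null => //; apply: filterS fE => x fE Ex.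
by have := fr x Ex; rewrite fE// ltxx.
Qed.

End threshold.

(** * Disintegration *)

Lemma preimage_pair_rvX d0 d1 d2 (Omega : measurableType d0)
    (T1 : measurableType d1) (T2 : measurableType d2) (R : realType)
    (P : probability Omega R) (Z : {RV P >-> T1} * {RV P >-> T2}) A B :
  pair_rv Z @^-1` (A `*` B) = Z.1 @^-1` A `&` Z.2 @^-1` B.
Proof. by []. Qed.

Section slice_integral.
Context d1 d2 d3 (S : measurableType d3) (T1 : measurableType d1)
  (T2 : measurableType d2) (R : realType).
Local Open Scope ereal_scope.
Variables (K : S -> pprobability T1 R) (x : S -> T2).
Hypothesis K_measurable : forall B, measurable B ->
  measurable_fun setT (fun s => K s B).
Hypothesis x_measurable : measurable_fun setT x.

Let ker : S -> {measure set T1 -> \bar R} := K.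

HB.instance Definition _ :=
  @isKernel.Build _ _ _ _ R ker (fun U mU => K_measurable mU).

Let ker_prob s : ker s setT = 1. Proof. exact: probability_setT. Qed.

HB.instance Definition _ := @Kernel_isProbability.Build _ _ _ _ R ker ker_prob.

Lemma ge0_measurable_slice_integral (g : T1 * T2 -> \bar R) :
  measurable_fun setT g -> (forall z, 0 <= g z) ->
  measurable_fun setT (fun s => \int[K s]_y g (y, x s)).
Proof.
move=> mg g0.
apply: (measurable_fun_integral_sfinite_kernel
  (fun sy => g (sy.2, x sy.1)) ker); first by [].
apply: measurableT_comp => //; apply/measurable_fun_pairP; split => /=.
  exact: measurable_snd.
exact: (measurableT_comp x_measurable).
Qed.

Lemma measurable_slice_integral (g : T1 * T2 -> \bar R) :
  measurable_fun setT g ->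
  measurable_fun setT (fun s => \int[K s]_y g (y, x s)).
Proof.
move=> mg.
under eq_fun do rewrite (integral_compE _ _ (fun y => (y, x _))).
apply: emeasurable_funB; apply: ge0_measurable_slice_integral => //.
- exact: measurable_funepos.
- exact: measurable_funeneg.
Qed.

End slice_integral.

Section disintegration.
Context d0 d1 d2 (Omega : measurableType d0) (T1 : measurableType d1)
  (T2 : measurableType d2) (R : realType) (P : probability Omega R).
Local Open Scope ereal_scope.
Variables (Y : {RV P >-> T1}) (X : {RV P >-> T2}).
Variable K : Omega -> pprobability T1 R.

Hypothesis K_measurable : forall B, measurable B ->
  measurable_fun setT (fun w => K w B).
Hypothesis K_law : forall C B, measurable C -> measurable B ->
  \int[P]_(w in X @^-1` C) K w B = P (X @^-1` C `&` Y @^-1` B).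

Let base (_ : unit) : {measure set Omega -> \bar R} := P.

Let base_measurable U : measurable U -> measurable_fun setT (base ^~ U).
Proof. by move=> mU; exact: measurable_cst. Qed.

HB.instance Definition _ := @isKernel.Build _ _ _ _ R base base_measurable.

Let base_prob u : base u setT = 1. Proof. exact: probability_setT. Qed.

HB.instance Definition _ :=
  @Kernel_isProbability.Build _ _ _ _ R base base_prob.

Let slice (x : T2) (y : T1) : T1 * T2 := (y, x).

Let slice_measurable x : measurable_fun setT (slice x).
Proof. exact: pair2_measurable. Qed.

HB.instance Definition _ x :=
  isMeasurableFun.Build _ _ _ _ (slice x) (slice_measurable x).

(** The law of (Y, X) given w: Y has law [K w] and X is frozen at [X w]. The
    dummy factor [unit] gives it the source type that composition with [base]
    requires. *)
Let glue (uw : unit * Omega) : {measure set (T1 * T2) -> \bar R} :=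
  distribution (K uw.2) (slice (X uw.2)).

Let glue_measurable U : measurable U -> measurable_fun setT (glue ^~ U).
Proof.
move=> mU.
pose g := fun z : T1 * T2 => (\1_U z)%:E : \bar R.
have : measurable_fun setT (fun w => \int[K w]_y g (y, X w)).
  apply: measurable_slice_integral => //.
  by apply/measurable_EFinP; exact: measurable_indic.
rewrite (_ : (fun w => _) = (fun w => K w (slice (X w) @^-1` U))).
  by move=> h; exact: (measurableT_comp h).
apply/funext => w; rewrite /g (eq_integral (EFin \o \1_(slice (X w) @^-1` U))).
  by rewrite integral_indic ?setIT// -[X in measurable X]setTI;
    exact: slice_measurable.
by move=> y _ /=; rewrite !indicE.
Qed.

HB.instance Definition _ := @isKernel.Build _ _ _ _ R glue glue_measurable.

Let glue_prob u : glue u setT = 1. Proof. exact: probability_setT. Qed.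

HB.instance Definition _ :=
  @Kernel_isProbability.Build _ _ _ _ R glue glue_prob.

Let mix := mkcomp base glue tt.

(** Two finite measures that agree on rectangles are equal, and on rectangles
    this is the defining property of a conditional distribution. *)
Let mixE U : measurable U -> mix U = distribution P (pair_rv (Y, X)) U.
Proof.
move=> mU.
symmetry; apply: (measure_unique
  [set A `*` B | A in measurable & B in measurable] (fun=> setT)) => //.
- exact: measurable_prod_measurableType.
- move=> _ _ [A1 mA1 [B1 mB1 <-]] [A2 mA2 [B2 mB2 <-]].
  exists (A1 `&` A2); first exact: measurableI.
  by exists (B1 `&` B2); [exact: measurableI|rewrite setXI].
- by move=> _; exists setT => //; exists setT => //; rewrite setXTT.
- by rewrite bigcup_const.
- move=> _ [B mB [C mC <-]]; symmetry.
  rewrite /mix /mkcomp/= /kcomp /base /distribution /pushforward/=.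
  rewrite preimage_pair_rvX setIC -K_law// [RHS]integral_mkcond.
  apply: eq_integral => w _.
  rewrite /glue /distribution /pushforward/= patchE.
  case: ifPn => [/set_mem wC|/negP wC].
    by congr (K w _); apply/seteqP; split => y //= [].
  rewrite (_ : _ @^-1` _ = set0) ?measure0//.
  by apply/seteqP; split => y //= [_ /= Xw]; case: wC; exact: mem_set.
- move=> _; apply: le_lt_trans (ltry _).
  exact: (probability_le1 (distribution P (pair_rv (Y, X))) measurableT).
Qed.

Lemma ge0_disintegration C (g : T1 * T2 -> \bar R) :
  measurable C -> measurable_fun setT g -> (forall z, 0 <= g z) ->
  \int[P]_(w in X @^-1` C) g (Y w, X w) =
  \int[P]_(w in X @^-1` C) \int[K w]_y g (y, X w).
Proof.
move=> mC mg g0.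
have mD : measurable (setT `*` C : set (T1 * T2)) by exact: measurableX.
(* Cutting [g] off outside [setT `*` C] turns integration over X in C into
   integration over the whole space. *)
pose h := g \_ (setT `*` C).
have mh : measurable_fun setT h.
  by apply/(measurable_restrictT _ _).1 => //; exact: measurable_funTS.
have h0 z : 0 <= h z by rewrite /h patchE; case: ifP.
transitivity (\int[distribution P (pair_rv (Y, X))]_z h z).
  rewrite ge0_integral_distribution// [LHS]integral_mkcond.
  apply: eq_integral => w _ /=; rewrite /h !patchE /=.
  suff -> : (w \in X @^-1` C) = (pair_rv (Y, X) w \in setT `*` C) by [].
  by apply/idP/idP => /set_mem wC; apply/mem_set => //; case: wC.
transitivity (\int[mix]_z h z).
  by apply: eq_measure_integral => U mU _; rewrite mixE.
rewrite /mix /mkcomp/= integral_kcomp// [RHS]integral_mkcond.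
apply: eq_integral => w _; rewrite /glue /= ge0_integral_distribution//.
rewrite patchE; case: ifPn => [/set_mem wC|/negP wC].
  by apply: eq_integral => y _ /=; rewrite /h patchE mem_set.
apply: integral0_eq => y _; rewrite /h /= patchE.
case: ifPn => // /set_mem [_ Xw].
by case: wC; exact: mem_set.
Qed.

End disintegration.

Section conditional_integral.
Context d0 (Omega : measurableType d0) (R : realType)
  (P : probability Omega R) (d p : nat).
Variable Z : {RV P >-> d.-tuple R} * {RV P >-> p.-tuple R}.
Variable K : Omega -> pprobability (d.-tuple R) R.
Hypothesis K_regular : regular_cond_dist Z K.
Local Open Scope ereal_scope.

Let OmegaX := g_sigma_algebra_preimageType Z.2.

Lemma sigma_regressor_measurable A :
  g_sigma_algebra_preimage Z.2 A -> measurable A.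
Proof. by move=> [C mC <-]; exact: (measurable_funPT Z.2). Qed.

Lemma sigma_regressor_measurable_fun d' (T : measurableType d')
    (f : Omega -> T) :
  measurable_fun (setT : set OmegaX) f -> measurable_fun setT f.
Proof.
by move=> mf _ B mB; apply: sigma_regressor_measurable; exact: (mf measurableT).
Qed.

Lemma regressor_measurable_fun : measurable_fun (setT : set OmegaX) Z.2.
Proof. by move=> _ B mB; exists B. Qed.

Let K_measurable B : measurable B -> measurable_fun setT (fun w => K w B).
Proof.
by move=> mB; apply: sigma_regressor_measurable_fun; exact: K_regular.1.
Qed.

Let K_law C B : measurable C -> measurable B ->
  \int[P]_(w in Z.2 @^-1` C) K w B = P (Z.2 @^-1` C `&` Z.1 @^-1` B).
Proof.
by move=> mC mB; apply: K_regular.2 => //; exists C => //; rewrite setTI.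
Qed.

(** Measurability is for sigma(X), so that comparing two conditional risks
    produces an event of sigma(X). *)
Lemma cond_integral_measurable (g : d.-tuple R * p.-tuple R -> \bar R) :
  measurable_fun setT g ->
  measurable_fun (setT : set OmegaX) (fun w => \int[K w]_y g (y, Z.2 w)).
Proof.
move=> mg; apply: (@measurable_slice_integral _ _ _ OmegaX) => //.
- exact: K_regular.1.
- exact: regressor_measurable_fun.
Qed.

Lemma ge0_integral_cond A (g : d.-tuple R * p.-tuple R -> \bar R) :
  g_sigma_algebra_preimage Z.2 A ->
  measurable_fun setT g -> (forall z, 0 <= g z) ->
  \int[P]_(w in A) \int[K w]_y g (y, Z.2 w) =
  \int[P]_(w in A) g (pair_rv Z w).
Proof.
move=> [C mC <-] mg g0.
by rewrite setTI -(ge0_disintegration K_measurable K_law).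
Qed.

Variable g : d.-tuple R * p.-tuple R -> \bar R.
Hypothesis g_measurable : measurable_fun setT g.
Hypothesis g_integrable : P.-integrable setT (g \o pair_rv Z).

Let sigmaT : g_sigma_algebra_preimage Z.2 setT.
Proof. by exists setT => //; rewrite setTI. Qed.

Let part_integrable (h : d.-tuple R * p.-tuple R -> \bar R) :
  measurable_fun setT h -> (forall z, 0 <= h z) ->
  P.-integrable setT (h \o pair_rv Z) ->
  P.-integrable setT (fun w => \int[K w]_y h (y, Z.2 w)).
Proof.
move=> mh h0 /integrableP[_ hoo]; apply/integrableP; split.
  exact/sigma_regressor_measurable_fun/cond_integral_measurable.
have pos w : 0 <= \int[K w]_y h (y, Z.2 w) by exact: integral_ge0.
under eq_integral do rewrite gee0_abs//.
rewrite ge0_integral_cond//; move: hoo.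
by under eq_integral do rewrite gee0_abs//=.
Qed.

Let pos_integrable : P.-integrable setT (g^\+ \o pair_rv Z).
Proof. by rewrite -funepos_comp; exact: integrable_funepos. Qed.

Let neg_integrable : P.-integrable setT (g^\- \o pair_rv Z).
Proof. by rewrite -funeneg_comp; exact: integrable_funeneg. Qed.

Let mpos := measurable_funepos g_measurable.
Let mneg := measurable_funeneg g_measurable.

Lemma cond_integral_integrable :
  P.-integrable setT (fun w => \int[K w]_y g (y, Z.2 w)).
Proof.
under eq_fun do rewrite (integral_compE _ _ (fun y => (y, Z.2 _))).
by apply: integrableB => //; exact: part_integrable.
Qed.

Lemma integral_cond A : g_sigma_algebra_preimage Z.2 A ->
  \int[P]_(w in A) \int[K w]_y g (y, Z.2 w) =
  \int[P]_(w in A) g (pair_rv Z w).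
Proof.
move=> sA; have mA := sigma_regressor_measurable sA.
under eq_integral do rewrite (integral_compE _ _ (fun y => (y, Z.2 _))).
rewrite integralB//; last 2 first.
- by apply: (integrableS measurableT) => //; exact: part_integrable.
- by apply: (integrableS measurableT) => //; exact: part_integrable.
by rewrite !ge0_integral_cond// [RHS](integral_compE _ _ (pair_rv Z)).
Qed.

End conditional_integral.

(** * Conditioning on an event of sigma(X) *)

Section conditioning.
Context d0 d1 d2 (Omega : measurableType d0) (T1 : measurableType d1)
  (T2 : measurableType d2) (R : realType) (P : probability Omega R).
Local Open Scope ereal_scope.
Variables (Z Z' : {RV P >-> T1} * {RV P >-> T2}) (A : set Omega).
Hypothesis sigmaA : g_sigma_algebra_preimage Z.2 A.
Hypothesis A_gt0 : 0 < P A.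
Hypothesis law : forall B, measurable B ->
  P (pair_rv Z' @^-1` B) = P (pair_rv Z @^-1` B `&` A) / P A.

Let A_fin : P A \is a fin_num.
Proof.
case: sigmaA => C mC <-; rewrite fin_num_measure//.
exact: (measurable_funPT Z.2).
Qed.

Lemma conditioned_law B : measurable B ->
  P A * P (pair_rv Z' @^-1` B) = P (pair_rv Z @^-1` B `&` A).
Proof.
move=> mB; rewrite law// muleC -muleA muleC.
rewrite -(fineK A_fin) inver; case: eqP => [A0|/eqP A0].
  by move: A_gt0; rewrite -(fineK A_fin) A0 ltxx.
by rewrite -EFinM mulVf// mul1e.
Qed.

Lemma conditioned_rectangle B C : measurable B -> measurable C ->
  P A * P (Z'.2 @^-1` C `&` Z'.1 @^-1` B) =
  P ((Z.2 @^-1` C `&` A) `&` Z.1 @^-1` B).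
Proof.
move=> mB mC; have := conditioned_law (measurableX mB mC).
rewrite !preimage_pair_rvX setIC => ->.
by rewrite setIAC [_ `&` Z.2 @^-1` C]setIC setIAC.
Qed.

Lemma conditioned_regressor C : measurable C ->
  P A * P (Z'.2 @^-1` C) = P (Z.2 @^-1` C `&` A).
Proof.
move=> mC; have := conditioned_rectangle measurableT mC.
by rewrite !preimage_setT !setIT.
Qed.

Lemma conditioned_null C : measurable C ->
  P (Z.2 @^-1` C `&` A) = 0 -> P (Z'.2 @^-1` C) = 0.
Proof.
move=> mC C0; have := conditioned_regressor mC.
rewrite C0 => /eqP; rewrite mule_eq0 => /orP[/eqP A0|/eqP//].
by move: A_gt0; rewrite A0 ltxx.
Qed.

(** Both sides live on [setT `*` C] where A is {X in C}; there the law of Z is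
    the multiple by [P A] of the law of Z'. *)
Lemma ge0_conditioned_integral (g : T1 * T2 -> \bar R) :
  measurable_fun setT g -> (forall z, 0 <= g z) ->
  P A * \int[P]_w g (pair_rv Z' w) = \int[P]_(w in A) g (pair_rv Z w).
Proof.
move=> mg g0; have [C mC AE] := sigmaA; rewrite setTI in AE.
pose D : set (T1 * T2) := setT `*` C.
have mD : measurable D by exact: measurableX.
have DA : pair_rv Z @^-1` D = A.
  by rewrite -AE; apply/seteqP; split => w //= [].
rewrite -(ge0_integral_distribution (pair_rv Z'))//.
rewrite (@ge0_negligible_integral _ _ _ _ setT (~` D))//; last 2 first.
- exact: measurableC.
- have := @conditioned_law (~` D) (measurableC mD).
  rewrite (_ : pair_rv Z @^-1` (~` D) = ~` A); last by rewrite -DA.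
  rewrite setICl measure0 => /eqP; rewrite mule_eq0.
  by rewrite (gt_eqF A_gt0) => /eqP.
rewrite setTD setCK.
pose c : {nonneg R} := NngNum (fine_ge0 (ltW A_gt0)).
have -> : P A = c%:num%:E by rewrite /= fineK.
rewrite -ge0_integral_mscale//; last exact: measurable_funTS.
rewrite -[in RHS]DA -(@ge0_integral_pushforward _ _ _ _ _
  (pair_rv Z) _ P D g)//.
- apply: eq_measure_integral => B mB BD.
  rewrite /= /mscale/= fineK// /distribution /pushforward conditioned_law//.
  by rewrite setIidl// -DA; exact: preimage_subset.
- exact: measurable_funTS.
Qed.

Lemma conditioned_integral (g : T1 * T2 -> \bar R) :
  measurable_fun setT g -> P.-integrable setT (g \o pair_rv Z') ->
  P A * \int[P]_w g (pair_rv Z' w) = \int[P]_(w in A) g (pair_rv Z w).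
Proof.
move=> mg ig.
have pos : \int[P]_w (g^\+ \o pair_rv Z') w \is a fin_num.
  rewrite -funepos_comp.
  by apply: integrable_fin_num => //; exact: integrable_funepos.
have neg : \int[P]_w (g^\- \o pair_rv Z') w \is a fin_num.
  rewrite -funeneg_comp.
  by apply: integrable_fin_num => //; exact: integrable_funeneg.
rewrite (integral_compE _ _ (pair_rv Z')).
rewrite muleBr//; last by rewrite fin_num_adde_defl// fin_numN.
rewrite !ge0_conditioned_integral//.
- by rewrite [RHS](integral_compE _ _ (pair_rv Z)).
- exact: measurable_funeneg.
- exact: measurable_funepos.
Qed.

End conditioning.

Section kernel_transfer.
Context d0 (Omega : measurableType d0) (R : realType)
  (P : probability Omega R) (d p : nat).
Local Open Scope ereal_scope.
Variables Z Z' : {RV P >-> d.-tuple R} * {RV P >-> p.-tuple R}.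
Variables K K' : Omega -> pprobability (d.-tuple R) R.
Hypotheses (K_regular : regular_cond_dist Z K)
  (K'_regular : regular_cond_dist Z' K').
Variable A : set Omega.
Hypothesis sigmaA : g_sigma_algebra_preimage Z.2 A.
Hypothesis A_gt0 : 0 < P A.
Hypothesis law : forall B, measurable B ->
  P (pair_rv Z' @^-1` B) = P (pair_rv Z @^-1` B `&` A) / P A.

Let threshold_set (V : {RV P >-> d.-tuple R} * {RV P >-> p.-tuple R})
    (L : Omega -> pprobability (d.-tuple R) R) B r :
  regular_cond_dist V L -> measurable B ->
  exists2 C, measurable C & [set w | L w B < r%:E] = V.2 @^-1` C.
Proof.
move=> L_regular mB.
have := L_regular.1 B mB measurableT [set` `]-oo, r%:E[] (emeasurable_itv _).
case=> C mC; by rewrite !setTI => CE; exists C.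
Qed.

(** Write {K(B) < r} as {X in C} and {K'(B) < r} as {X' in D}. On C without D,
    K(B) is below r while K'(B) is not, and yet both have the same integral up
    to the factor [P A], since it is determined by the law of the pair; hence
    that set is null, and so is D without C. *)
Let transfer_threshold B r : measurable B -> (0 <= r)%R ->
  exists C, [/\ measurable C, [set w | K w B < r%:E] = Z.2 @^-1` C &
    {ae P, forall w, K' w B < r%:E <-> C (Z'.2 w)}].
Proof.
move=> mB r0.
have [C mC CE] := threshold_set r K_regular mB.
have [D mD DE] := threshold_set r K'_regular mB.
exists C; split => //.
have KC w : C (Z.2 w) <-> K w B < r%:E.
  by rewrite -[C _]/((Z.2 @^-1` C) w) -CE.
have KD w : D (Z'.2 w) <-> K' w B < r%:E.
  by rewrite -[D _]/((Z'.2 @^-1` D) w) -DE.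
have sigmaS S : measurable S ->
    g_sigma_algebra_preimage Z.2 (Z.2 @^-1` S `&` A).
  case: sigmaA => C0 mC0 <- mS; exists (S `&` C0); first exact: measurableI.
  by rewrite !setTI.
have mA S : measurable S -> measurable (Z.2 @^-1` S `&` A).
  by move=> mS; exact: sigma_regressor_measurable (sigmaS S mS).
have sigmaS' S : measurable S -> g_sigma_algebra_preimage Z'.2 (Z'.2 @^-1` S).
  by move=> mS; exists S => //; rewrite setTI.
have mS' S : measurable S -> measurable (Z'.2 @^-1` S).
  by move=> mS; exact: sigma_regressor_measurable (sigmaS' S mS).
have mK (V : {RV P >-> d.-tuple R} * {RV P >-> p.-tuple R}) L E :
    regular_cond_dist V L -> measurable_fun E (fun w => L w B).
  move=> LR; apply: measurable_funTS.
  exact: sigma_regressor_measurable_fun (LR.1 B mB).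
have link S : measurable S ->
    P A * \int[P]_(w in Z'.2 @^-1` S) K' w B =
    \int[P]_(w in Z.2 @^-1` S `&` A) K w B.
  move=> mS; rewrite (K'_regular.2 _ _ (sigmaS' S mS) mB).
  rewrite (K_regular.2 _ _ (sigmaS S mS) mB).
  exact: (conditioned_rectangle sigmaA A_gt0 law).
have nullCD : P (Z'.2 @^-1` (C `\` D)) = 0.
  have mCD : measurable (C `\` D) by exact: measurableD.
  apply: (conditioned_null sigmaA A_gt0 law mCD).
  apply: (@lt_threshold_null _ _ _ P _ (fun w => K w B) r) => //.
  - exact: mA.
  - exact: mK K_regular.
  - by move=> w [[Cw _] _]; apply/KC.
  - rewrite -link//.
    rewrite -[X in _ * X <= _](conditioned_regressor sigmaA A_gt0 law mCD).
    rewrite muleCA lee_wpmul2l//.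
    apply: le_threshold_integral => //.
    + exact: mS'.
    + exact: mK K'_regular.
    + by move=> w [_ Dw]; rewrite leNgt; apply/negP => /KD.
have nullDC : P (Z'.2 @^-1` (D `\` C)) = 0.
  have mDC : measurable (D `\` C) by exact: measurableD.
  apply: (@lt_threshold_null _ _ _ P _ (fun w => K' w B) r) => //.
  - exact: mS'.
  - exact: mK K'_regular.
  - by move=> w [Dw _]; apply/KD.
  - rewrite -(@lee_pmul2l _ (P A))//; last first.
      by rewrite fin_num_measure//; exact: sigma_regressor_measurable sigmaA.
    rewrite link// muleCA.
    rewrite [X in _ * X <= _](conditioned_regressor sigmaA A_gt0 law mDC).
    apply: le_threshold_integral => //.
    + exact: mA.
    + exact: mK K_regular.
    + by move=> w [[_ Cw] _]; rewrite leNgt; apply/negP => /KC.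
have aeCD := ae_notin (mS' _ (measurableD mC mD)) nullCD.
have aeDC := ae_notin (mS' _ (measurableD mD mC)) nullDC.
apply: filterS2 aeCD aeDC => w CDw DCw; split => [/KD Dw|Cw].
  by apply: contrapT => nC; apply: DCw.
by apply/KD; apply: contrapT => nD; apply: CDw.
Qed.

(** The sets [E] with the property form a sigma-algebra. The set [C] is kept
    in common for both kernels: it lets statements about the joint behaviour of
    (X, K) pass to (X', K'). *)
Lemma transfer_kernel_event (E : set (pprobability (d.-tuple R) R)) :
  measurable E ->
  exists C, [/\ measurable C, K @^-1` E = Z.2 @^-1` C &
    {ae P, forall w, E (K' w) <-> C (Z'.2 w)}].
Proof.
pose G := [set E : set (pprobability (d.-tuple R) R) |
  exists C, [/\ measurable C, K @^-1` E = Z.2 @^-1` C &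
    {ae P, forall w, E (K' w) <-> C (Z'.2 w)}]].
suff : measurable `<=` G by exact.
apply: smallest_sub; last first.
  move=> F [r]; rewrite /= in_itv/= => /andP[r0 _] [B mB <-].
  have [C [mC CE aeC]] := transfer_threshold mB r0.
  by exists C; split; [exact: mC|exact: CE|exact: aeC].
split.
- exists set0; split; first exact: measurable0.
    by rewrite !preimage_set0.
  by apply: aeW => w; split; case.
- move=> F [C [mC CE aeC]]; rewrite setTD; exists (~` C); split.
  + exact: measurableC.
  + by rewrite -[LHS]/(~` (K @^-1` F)) CE.
  + by apply: filterS aeC => w [FC CF]; split => h; [move=> /CF|move=> /FC].
- move=> F mF; have [C FC] := choice mF; exists (\bigcup_n C n); split.
  + by apply: bigcupT_measurable => n; have [] := FC n.
  + by rewrite !preimage_bigcup; apply: eq_bigcupr => n _; have [] := FC n.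
  + have : {ae P, forall w, forall n, F n (K' w) <-> C n (Z'.2 w)}.
      by apply: ae_foralln => n; have [] := FC n.
    by apply: filterS => w Fw; split => -[n _ /Fw nw]; exists n.
Qed.

End kernel_transfer.

Section tuple_separation.
Context (R : realType) (k : nat).

Definition coordinate_ray (iq : 'I_k * rat) : set (k.-tuple R) :=
  [set t | tnth t iq.1 < ratr iq.2].

Lemma measurable_coordinate_ray iq : measurable (coordinate_ray iq).
Proof.
have := @measurable_tnth _ _ _ iq.1 measurableT `]-oo, (ratr iq.2 : R)[%classic.
rewrite setTI => /(_ (measurable_itv _)) h.
by rewrite (_ : coordinate_ray iq =
  (tnth (T:=R))^~ iq.1 @^-1` `]-oo, ratr iq.2[)//.
Qed.

Lemma coordinate_ray_separates (s t : k.-tuple R) :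
  (forall iq, coordinate_ray iq s <-> coordinate_ray iq t) -> s = t.
Proof.
move=> st; apply: eq_from_tnth => i; apply/eqP; rewrite eq_le.
apply/andP; split; rewrite leNgt; apply/negP => /rat_in_itvoo[q];
  rewrite in_itv/= => /andP[lo hi].
- by have /= := (st (i, q)).2 lo; rewrite /coordinate_ray/= ltNge ltW.
- by have /= := (st (i, q)).1 lo; rewrite /coordinate_ray/= ltNge ltW.
Qed.

End tuple_separation.

Section functional_transfer.
Context d0 (Omega : measurableType d0) (R : realType)
  (P : probability Omega R) (d p k : nat).
Local Open Scope ereal_scope.
Variables Z Z' : {RV P >-> d.-tuple R} * {RV P >-> p.-tuple R}.
Variables K K' : Omega -> pprobability (d.-tuple R) R.
Hypotheses (K_regular : regular_cond_dist Z K)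
  (K'_regular : regular_cond_dist Z' K').
Variable A : set Omega.
Hypothesis sigmaA : g_sigma_algebra_preimage Z.2 A.
Hypothesis A_gt0 : 0 < P A.
Hypothesis law : forall B, measurable B ->
  P (pair_rv Z' @^-1` B) = P (pair_rv Z @^-1` B `&` A) / P A.
Variables (F : set (pprobability (d.-tuple R) R))
  (Gamma : pprobability (d.-tuple R) R -> k.-tuple R)
  (h : p.-tuple R -> k.-tuple R).
Hypothesis Gamma_measurable : measurable_in_trace F Gamma.
Hypothesis h_measurable : measurable_fun setT h.
Hypotheses (KF : {ae P, forall w, F (K w)}) (K'F : {ae P, forall w, F (K' w)}).

(** Equality of two vectors is tested by countably many events
    {h(X) in B} and {Gamma(K) in B}. With one Borel set C the
    latter are {X in C} and {X' in C} up to null sets, so both events agree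
    almost surely iff the regressor almost surely avoids a Borel set, and this
    passes from the law of X given A to the law of X'. *)
Lemma transfer_functional :
  {ae P, forall w, h (Z.2 w) = Gamma (K w)} ->
  {ae P, forall w, h (Z'.2 w) = Gamma (K' w)}.
Proof.
move=> hGamma.
suff event B : measurable B ->
    {ae P, forall w, B (h (Z'.2 w)) <-> B (Gamma (K' w))}.
  have : {ae P, forall w, forall iq : 'I_k * rat,
      coordinate_ray iq (h (Z'.2 w)) <-> coordinate_ray iq (Gamma (K' w))}.
    apply: ae_forall_countable => iq; apply: event.
    exact: measurable_coordinate_ray.
  by apply: filterS => w; exact: coordinate_ray_separates.
move=> mB; have [E mE FE] := Gamma_measurable mB.
have EB mu : F mu -> E mu <-> B (Gamma mu).
  move=> Fmu; split => [Emu|Bmu].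
    have : (F `&` E) mu by [].
    by rewrite -FE => -[].
  have : (F `&` Gamma @^-1` B) mu by [].
  by rewrite FE => -[].
have [C [mC KC aeC]] :=
  transfer_kernel_event K_regular K'_regular sigmaA A_gt0 law mE.
have mhB : measurable (h @^-1` B).
  by rewrite -[X in measurable X]setTI; exact: h_measurable.
pose N := (h @^-1` B `\` C) `|` (C `\` h @^-1` B).
have mN : measurable N by apply: measurableU; exact: measurableD.
have nullN : P (Z'.2 @^-1` N) = 0.
  apply: (conditioned_null sigmaA A_gt0 law mN).
  have mXN : measurable (Z.2 @^-1` N).
    by rewrite -[X in measurable X]setTI; exact: (measurable_funPT Z.2).
  have mA : measurable A by exact: sigma_regressor_measurable sigmaA.
  apply: ae_notin_null; first exact: measurableI.
  apply: filterS2 hGamma KF => w hw Fw [Nw _].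
  have CE : C (Z.2 w) <-> E (K w).
    by rewrite -[C _]/((Z.2 @^-1` C) w) -KC.
  have := EB _ Fw; rewrite -hw => EBw.
  by case: Nw => -[/= a b]; tauto.
have aeN : {ae P, forall w, ~ N (Z'.2 w)}.
  apply: (@ae_notin _ _ _ P (Z'.2 @^-1` N)) => //.
  by rewrite -[X in measurable X]setTI; exact: (measurable_funPT Z'.2).
apply: filterS3 aeN aeC K'F => w Nw Cw Fw.
have := EB _ Fw => EBw.
have : ~ ((h @^-1` B `\` C) (Z'.2 w)) /\ ~ ((C `\` h @^-1` B) (Z'.2 w)).
  by split=> Nw'; apply: Nw; [left|right].
rewrite /= => -[n1 n2]; split => [Bh|BG].
  by apply/EBw/Cw; apply: contrapT => nC; apply: n1.
by apply: contrapT => nB; apply: n2; split => //; exact/Cw/EBw.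
Qed.

End functional_transfer.

(** * Continuous functions on a subset of R^q *)

Section countable_dense.
Context (R : realType) (q : nat).

(** For each rational centre and each radius 1/(n+1), pick a point of [A] in the
    ball if there is one; the default [a0] keeps all values of [f] in [A]. *)
Lemma countable_dense_subset (A : set 'rV[R]_q) (a0 : 'rV[R]_q) : A a0 ->
  exists f : 'rV[rat]_q * nat -> 'rV[R]_q,
    (forall i, A (f i)) /\
    forall a U, A a -> nbhs a U -> exists i, U (f i).
Proof.
move=> Aa0.
pose near_ (i : 'rV[rat]_q * nat) :=
  ball (map_mx ratr i.1 : 'rV[R]_q) i.2.+1%:R^-1.
pose f i := xget a0 (A `&` near_ i).
exists f; split => [i|a U Aa].
  by rewrite /f; case: xgetP => // _ -> [].
move=> /nbhs_ballP[e /= e0 eU].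
have [n ne] : exists n : nat, (n.+1%:R^-1 : R) < e / 2.
  have e2 : 0 < e / 2 by rewrite divr_gt0.
  have [n _ ne] := near_infty_natSinv_lt (PosNum e2).
  by exists n; exact: (ne n (leqnn n)).
have [r ar] : exists r : 'rV[rat]_q,
    ball (map_mx ratr r : 'rV[R]_q) n.+1%:R^-1 a.
  have : forall j : 'I_q, exists x : rat,
      ball (ratr x : R) n.+1%:R^-1 (a ord0 j).
    move=> j; have : a ord0 j - n.+1%:R^-1 < a ord0 j by rewrite ltrBlDr ltrDl.
    move=> /rat_in_itvoo[x]; rewrite in_itv/= => /andP[lo hi]; exists x.
    by rewrite /ball/= ltr_distl lo/= (lt_trans hi)// ltrDl.
  move=> /choice[x ax]; exists (\row_j x j); split => // i j.
  by rewrite ord1 !mxE.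
exists (r, n); apply: eU.
have : (A `&` near_ (r, n)) (f (r, n)).
  by rewrite /f; case: xgetP => // /(_ a) []; split.
move=> [_ fr]; apply: ball_splitr.
  by apply: le_ball ar; exact: ltW.
by apply: le_ball fr; exact: ltW.
Qed.

Lemma within_continuous_ge (A : set 'rV[R]_q) (I : Type) (f : I -> 'rV[R]_q)
    (g : 'rV[R]_q -> R) (c : R) :
  (forall i, A (f i)) ->
  (forall a U, A a -> nbhs a U -> exists i, U (f i)) ->
  {within A, continuous g} -> (forall i, c <= g (f i)) ->
  forall a, A a -> c <= g a.
Proof.
move=> fA dense gc cf a Aa; rewrite leNgt; apply/negP => gac.
have : within A (nbhs a) [set x | g x < c].
  move/subspace_continuousP : gc => /(_ a Aa) ga.
  by apply: (ga [set y | y < c]); exact: lt_nbhsl.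
move=> /(dense a _ Aa)[i] /= /(_ (fA i)); rewrite ltNge.
by rewrite cf.
Qed.

End countable_dense.

(** * Consistency and model-consistency *)

Section model_consistency.
Context d0 (Omega : measurableType d0) (R : realType)
  (P : probability Omega R) (d p k q : nat).
Variables (Xs : set {RV P >-> p.-tuple R})
  (Zs : set ({RV P >-> d.-tuple R} * {RV P >-> p.-tuple R}))
  (K : {RV P >-> d.-tuple R} * {RV P >-> p.-tuple R} ->
       Omega -> pprobability (d.-tuple R) R)
  (Om : {RV P >-> d.-tuple R} * {RV P >-> p.-tuple R} -> set Omega)
  (Xi : set (k.-tuple R)) (Gamma : pprobability (d.-tuple R) R -> k.-tuple R)
  (Theta : set 'rV[R]_q) (m : p.-tuple R -> 'rV[R]_q -> k.-tuple R)
  (theta0 : pprobability (d.-tuple R * p.-tuple R)%type R -> 'rV[R]_q)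
  (rho : d.-tuple R -> k.-tuple R -> R).
Hypotheses
  (Zs_regressor : forall Z, Zs Z -> Xs Z.2)
  (K_regular : forall Z, Zs Z -> regular_cond_dist Z (K Z))
  (Om_full : full_measure_choice Zs Om)
  (m_Xi : forall x theta, Theta theta -> Xi (m x theta))
  (theta0_Theta : forall Z, Zs Z -> Theta (true_parameter theta0 Z))
  (theta0_true : forall Z, Zs Z ->
     {ae P, forall w, m (Z.2 w) (true_parameter theta0 Z) = Gamma (K Z w)})
  (theta0_unique : forall Z theta, Zs Z -> Theta theta ->
     {ae P, forall w, m (Z.2 w) theta = Gamma (K Z w)} ->
     theta = true_parameter theta0 Z)
  (rho_measurable : forall theta, Theta theta ->
     measurable_fun setT
       (fun yx : d.-tuple R * p.-tuple R => rho yx.1 (m yx.2 theta)))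
  (rho_integrable : forall Z theta, Zs Z -> Theta theta ->
     ('E_P[fun w => `|rho (Z.1 w) (m (Z.2 w) theta)|%R] < +oo)%E).
Local Open Scope ereal_scope.

Let loss theta (yx : d.-tuple R * p.-tuple R) : \bar R :=
  (rho yx.1 (m yx.2 theta))%:E.

Let loss_measurable theta : Theta theta -> measurable_fun setT (loss theta).
Proof. by move=> Tt; apply/measurable_EFinP; exact: rho_measurable. Qed.

Let loss_integrable Z theta : Zs Z -> Theta theta ->
  P.-integrable setT (loss theta \o pair_rv Z).
Proof.
move=> ZZ Tt; apply/integrableP; split.
  apply: measurableT_comp; first exact: loss_measurable.
  exact: (measurable_funPT (pair_rv Z)).
by have := rho_integrable ZZ Tt; rewrite unlock.
Qed.

Let cond_risk_integrable Z theta : Zs Z -> Theta theta ->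
  P.-integrable setT (cond_risk K m rho Z theta).
Proof.
move=> ZZ Tt.
exact: (cond_integral_integrable (K_regular ZZ) (loss_measurable Tt)
  (loss_integrable ZZ Tt)).
Qed.

Let integral_cond_risk Z theta A : Zs Z -> Theta theta ->
  g_sigma_algebra_preimage Z.2 A ->
  \int[P]_(w in A) cond_risk K m rho Z theta w =
  \int[P]_(w in A) loss theta (pair_rv Z w).
Proof.
move=> ZZ Tt sA.
exact: (integral_cond (K_regular ZZ) (loss_measurable Tt)
  (loss_integrable ZZ Tt) sA).
Qed.

Let risk_cond_risk Z theta : Zs Z -> Theta theta ->
  risk m rho Z theta = \int[P]_w cond_risk K m rho Z theta w.
Proof.
move=> ZZ Tt; rewrite integral_cond_risk//; first by rewrite /risk unlock.
by exists setT => //; rewrite setTI.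
Qed.

Let ae_in_class Z : Zs Z -> {ae P, forall w, cond_dist_class Zs K Om (K Z w)}.
Proof.
move=> ZZ; have [mOm POm] := Om_full ZZ.
by apply: filterS (ae_full mOm POm) => w Omw; exists Z => //; exists w.
Qed.

Lemma consistent_cond :
  consistent (cond_dist_class Zs K Om) Xi Gamma rho ->
  cond_model_consistent Zs K Theta m theta0 rho.
Proof.
move=> [_ le] Z theta ZZ Tt.
apply: filterS2 (ae_in_class ZZ) (theta0_true ZZ) => w Kw mw.
by rewrite /cond_risk mw; apply: le => //; exact: m_Xi.
Qed.

Lemma strictly_consistent_cond :
  strictly_consistent (cond_dist_class Zs K Om) Xi Gamma rho ->
  strictly_cond_model_consistent Zs K Theta m theta0 rho.
Proof.
move=> [cons strict]; split; first exact: consistent_cond.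
move=> Z theta ZZ Tt eq_risk; apply: theta0_unique => //.
apply: filterS3 (ae_in_class ZZ) (theta0_true ZZ) eq_risk => w Kw mw.
by rewrite /cond_risk mw => /strict; apply => //; exact: m_Xi.
Qed.

Lemma cond_uncond :
  cond_model_consistent Zs K Theta m theta0 rho ->
  uncond_model_consistent Zs Theta m theta0 rho.
Proof.
move=> cons Z theta ZZ Tt; have T0 := theta0_Theta ZZ.
rewrite !risk_cond_risk//; apply: ae_le_integral => //.
- exact: cond_risk_integrable.
- exact: cond_risk_integrable.
- by apply: filterS (cons Z theta ZZ Tt).
Qed.

Lemma strictly_cond_uncond :
  strictly_cond_model_consistent Zs K Theta m theta0 rho ->
  strictly_uncond_model_consistent Zs Theta m theta0 rho.
Proof.
move=> [cons strict]; split; first exact: cond_uncond.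
move=> Z theta ZZ Tt; have T0 := theta0_Theta ZZ.
rewrite !risk_cond_risk// => eq_risk; apply: strict => //.
have : ae_eq P setT (cond_risk K m rho Z (true_parameter theta0 Z))
    (cond_risk K m rho Z theta).
  apply: ae_le_integral_eq => //.
  - exact: cond_risk_integrable.
  - exact: cond_risk_integrable.
  - by apply: filterS (cons Z theta ZZ Tt).
by apply: filterS => w; apply.
Qed.

(** Only the countably many parameters [f i] are handled almost surely; all
    others follow by continuity for each outcome separately. *)
Lemma cond_consistent_modification :
  (forall X, Xs X -> {ae P, forall w, set_surj Theta Xi (m (X w))}) ->
  (forall Z, Zs Z -> cond_risk_continuous K Theta m rho Z) ->
  cond_model_consistent Zs K Theta m theta0 rho ->
  exists Om', [/\ full_measure_choice Zs Om',
    cond_dist_class Zs K Om' `<=` cond_dist_class Zs K Om &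
    consistent (cond_dist_class Zs K Om') Xi Gamma rho].
Proof.
move=> surj cont cons.
pose good Z := [set w | [/\ Om Z w,
  forall xi, Xi xi -> (K Z w).-integrable setT (fun y => (rho y xi)%:E) &
  forall xi, Xi xi -> \int[K Z w]_y (rho y (Gamma (K Z w)))%:E <=
                      \int[K Z w]_y (rho y xi)%:E]].
have ae_good Z : Zs Z -> {ae P, forall w, good Z w}.
  move=> ZZ; have T0 := theta0_Theta ZZ.
  have [f [fT fdense]] := countable_dense_subset T0.
  have ae_le : {ae P, forall w, forall i, cond_risk K m rho Z
      (true_parameter theta0 Z) w <= cond_risk K m rho Z (f i) w}.
    by apply: ae_forall_countable => i; exact: cons.
  have [mOm POm] := Om_full ZZ.
  have ae_regular : {ae P, forall w, [/\ Om Z w,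
      m (Z.2 w) (true_parameter theta0 Z) = Gamma (K Z w) &
      set_surj Theta Xi (m (Z.2 w))]}.
    by apply: filterS3 (ae_full mOm POm) (theta0_true ZZ)
      (surj _ (Zs_regressor ZZ)) => w.
  apply: filterS3 ae_regular ae_le (cont Z ZZ) =>
    w [Omw mw surjw] lew [finw contw].
  split => // xi /surjw[theta Tt <-].
    apply: fin_num_integrable => //; last exact: (finw theta Tt).
    apply/measurable_EFinP.
    exact: measurableT_comp (rho_measurable Tt) (pair2_measurable _).
  rewrite -mw -/(cond_risk K m rho Z _ w) -/(cond_risk K m rho Z _ w).
  rewrite -(fineK (finw _ T0)) -(fineK (finw _ Tt)) lee_fin.
  apply: (within_continuous_ge fT fdense contw) => // i.
  by rewrite -lee_fin !fineK ?finw//; apply: finw.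
have full_good Z : exists O : set Omega, Zs Z ->
    [/\ measurable O, P O = 1 & O `<=` good Z].
  have [ZZ|nZ] := pselect (Zs Z); last by exists setT.
  have [N [mN N0 Ngood]] := ae_good Z ZZ; exists (~` N) => _; split.
  - exact: measurableC.
  - by rewrite probability_setC// N0 sube0.
  - by move=> w Nw; apply: contrapT => bad; apply: Nw; exact: Ngood.
have [Om' Om'P] := choice full_good.
exists Om'; split.
- by move=> Z ZZ; have [] := Om'P Z ZZ.
- move=> _ [Z ZZ [w Omw <-]]; exists Z => //; exists w => //.
  by have [_ _ /(_ w Omw)[]] := Om'P Z ZZ.
- split=> mu xi [Z ZZ [w Omw <-]] Xxi;
    have [_ _ /(_ w Omw)[_ int le]] := Om'P Z ZZ.
  + exact: int.
  + exact: le.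
Qed.

Hypothesis Gamma_measurable :
  measurable_in_trace (cond_dist_class Zs K Om) Gamma.
Hypothesis m_measurable : forall theta, Theta theta ->
  measurable_fun setT (m^~ theta).
Hypothesis conditioning : closed_under_conditioning Zs.

(** The pair Z' with the law of Z given A has the same true parameter as Z, so
    its unconditional consistency contradicts the choice of A unless
    [P A = 0]. *)
Lemma uncond_cond :
  uncond_model_consistent Zs Theta m theta0 rho ->
  cond_model_consistent Zs K Theta m theta0 rho.
Proof.
move=> cons Z theta ZZ Tt; have T0 := theta0_Theta ZZ.
pose r0 := cond_risk K m rho Z (true_parameter theta0 Z).
pose r1 := cond_risk K m rho Z theta.
pose A := [set w | r1 w < r0 w].
have mr t : Theta t -> measurable_fun
    (setT : set (g_sigma_algebra_preimageType Z.2)) (cond_risk K m rho Z t).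
  move=> Tt'.
  exact: (cond_integral_measurable (K_regular ZZ) (loss_measurable Tt')).
have sigmaA : g_sigma_algebra_preimage Z.2 A.
  have := measurable_lte measurableT (mr _ Tt) (mr _ T0).
  by rewrite setTI.
have mA : measurable A by exact: sigma_regressor_measurable sigmaA.
suff A0 : P A = 0.
  apply: filterS (ae_notin mA A0) => w Aw.
  by rewrite leNgt; apply/negP.
apply/eqP; rewrite eq_le measure_ge0 andbT leNgt; apply/negP => A_gt0.
have [Z' ZZ' law] := conditioning ZZ sigmaA A_gt0.
have true_eq : true_parameter theta0 Z = true_parameter theta0 Z'.
  apply: theta0_unique => //.
  apply: (transfer_functional (K_regular ZZ) (K_regular ZZ') sigmaA A_gt0 law
    Gamma_measurable (m_measurable T0)) (theta0_true ZZ).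
  - exact: ae_in_class.
  - exact: ae_in_class.
have le01 : \int[P]_(w in A) r0 w <= \int[P]_(w in A) r1 w.
  rewrite !integral_cond_risk//.
  rewrite -(conditioned_integral sigmaA A_gt0 law (loss_measurable T0)
    (loss_integrable ZZ' T0)).
  rewrite -(conditioned_integral sigmaA A_gt0 law (loss_measurable Tt)
    (loss_integrable ZZ' Tt)).
  apply: lee_wpmul2l => //.
  by have := cons Z' theta ZZ' Tt; rewrite -true_eq /risk unlock.
have ir t : Theta t -> P.-integrable A (cond_risk K m rho Z t).
  move=> Tt'; apply: (integrableS measurableT) => //.
  exact: cond_risk_integrable.
have aeA : ae_eq P A r1 r0.
  apply: ae_le_integral_eq => //; [exact: ir|exact: ir| |].
  - by apply: aeW => w; exact: ltW.
  - apply/eqP; rewrite eq_le le01 andbT; apply: le_integral => //.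
    + exact: ir.
    + exact: ir.
    + by move=> w /set_mem; exact: ltW.
have A0 : P A = 0.
  apply: ae_notin_null => //; apply: filterS aeA => w r10 Aw.
  by have := Aw; rewrite /A /= r10// ltxx.
by move: A_gt0; rewrite A0 ltxx.
Qed.

Lemma strictly_uncond_cond :
  strictly_uncond_model_consistent Zs Theta m theta0 rho ->
  strictly_cond_model_consistent Zs K Theta m theta0 rho.
Proof.
move=> [cons strict]; split; first exact: uncond_cond.
move=> Z theta ZZ Tt eq_risk; apply: strict => //; have T0 := theta0_Theta ZZ.
rewrite !risk_cond_risk//; apply: ae_eq_integral => //.
- exact: measurable_int (cond_risk_integrable ZZ T0).
- exact: measurable_int (cond_risk_integrable ZZ Tt).
- by apply: filterS eq_risk.
Qed.

End model_consistency.

Theorem theorem1 (d0 : measure_display) (Omega : measurableType d0)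
    (R : realType) (P : probability Omega R)
    (P_nonatomic : nonatomic P) (P_complete : measure_is_complete P)
    (d p k q : nat)
    (Ys : set {RV P >-> d.-tuple R}) (Xs : set {RV P >-> p.-tuple R})
    (Zs : set ({RV P >-> d.-tuple R} * {RV P >-> p.-tuple R}))
    (ZsYX : Zs `<=` Ys `*` Xs)
    (K : {RV P >-> d.-tuple R} * {RV P >-> p.-tuple R} ->
         Omega -> pprobability (d.-tuple R) R)
    (K_regular : forall Z, Zs Z -> regular_cond_dist Z (K Z))
    (Om : {RV P >-> d.-tuple R} * {RV P >-> p.-tuple R} -> set Omega)
    (Om_full : full_measure_choice Zs Om)
    (Xi : set (k.-tuple R)) (Gamma : pprobability (d.-tuple R) R -> k.-tuple R)
    (Gamma_Xi : forall mu, cond_dist_class Zs K Om mu -> Xi (Gamma mu))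
    (Theta : set 'rV[R]_q) (Theta_int : interior Theta !=set0)
    (m : p.-tuple R -> 'rV[R]_q -> k.-tuple R)
    (m_Xi : forall x theta, Theta theta -> Xi (m x theta))
    (theta0 : pprobability (d.-tuple R * p.-tuple R)%type R -> 'rV[R]_q)
    (theta0_int : forall Z, Zs Z -> interior Theta (true_parameter theta0 Z))
    (theta0_true : forall Z, Zs Z ->
       {ae P, forall w, m (Z.2 w) (true_parameter theta0 Z) = Gamma (K Z w)})
    (theta0_unique : forall Z theta, Zs Z -> Theta theta ->
       {ae P, forall w, m (Z.2 w) theta = Gamma (K Z w)} ->
       theta = true_parameter theta0 Z)
    (rho : d.-tuple R -> k.-tuple R -> R)
    (rho_measurable : forall theta, Theta theta ->
       measurable_fun setT
         (fun yx : d.-tuple R * p.-tuple R => rho yx.1 (m yx.2 theta)))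
    (rho_integrable : forall Z theta, Zs Z -> Theta theta ->
       ('E_P[fun w => `|rho (Z.1 w) (m (Z.2 w) theta)|%R] < +oo)%E) :
  (* (i) *)
  ((consistent (cond_dist_class Zs K Om) Xi Gamma rho ->
      cond_model_consistent Zs K Theta m theta0 rho) /\
   (strictly_consistent (cond_dist_class Zs K Om) Xi Gamma rho ->
      strictly_cond_model_consistent Zs K Theta m theta0 rho)) /\
  (* (ii) *)
  ((forall X, Xs X -> {ae P, forall w, set_surj Theta Xi (m (X w))}) ->
   (forall Z, Zs Z -> cond_risk_continuous K Theta m rho Z) ->
   cond_model_consistent Zs K Theta m theta0 rho ->
   (* Gamma is defined on the given class only, hence the inclusion *)
   exists Om', [/\ full_measure_choice Zs Om',
     cond_dist_class Zs K Om' `<=` cond_dist_class Zs K Om &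
     consistent (cond_dist_class Zs K Om') Xi Gamma rho]) /\
  (* (iii) *)
  ((cond_model_consistent Zs K Theta m theta0 rho ->
      uncond_model_consistent Zs Theta m theta0 rho) /\
   (strictly_cond_model_consistent Zs K Theta m theta0 rho ->
      strictly_uncond_model_consistent Zs Theta m theta0 rho)) /\
  (* (iv) *)
  (* Gamma and m(., theta) are measurable, distributions carrying the
     sigma-algebra generated by the evaluations at Borel sets *)
  (measurable_in_trace (cond_dist_class Zs K Om) Gamma ->
   (forall theta, Theta theta -> measurable_fun setT (m^~ theta)) ->
   closed_under_conditioning Zs ->
   (uncond_model_consistent Zs Theta m theta0 rho ->
      cond_model_consistent Zs K Theta m theta0 rho) /\
   (strictly_uncond_model_consistent Zs Theta m theta0 rho ->
      strictly_cond_model_consistent Zs K Theta m theta0 rho)).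
Proof.
have regressors Z : Zs Z -> Xs Z.2 by move=> /ZsYX[].
have inTheta Z : Zs Z -> Theta (true_parameter theta0 Z).
  by move=> ZZ; exact: interior_subset (theta0_int Z ZZ).
split; [|split; [|split]].
- split.
  + exact: (consistent_cond Om_full m_Xi theta0_true).
  + exact: (strictly_consistent_cond Om_full m_Xi theta0_true theta0_unique).
- exact: (cond_consistent_modification regressors Om_full inTheta theta0_true
    rho_measurable).
- split.
  + exact: (cond_uncond K_regular inTheta rho_measurable rho_integrable).
  + exact: (strictly_cond_uncond K_regular inTheta rho_measurable
      rho_integrable).
- move=> Gamma_measurable m_measurable conditioning; split.
  + exact: (uncond_cond K_regular Om_full inTheta theta0_true theta0_unique
      rho_measurable rho_integrable Gamma_measurable m_measurable conditioning).
  + exact: (strictly_uncond_cond K_regular Om_full inTheta theta0_true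
      theta0_unique rho_measurable rho_integrable Gamma_measurable m_measurable
      conditioning).
Qed.
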